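(* Let $(\Phi,G)$ be a generalized metric CRF-structure on $M$ with the associated structures $(F_\pm,\gamma,\psi)$, and let $\nabla$ be the Levi-Civita connection of $\gamma$. Then $(\Phi,G)$ is a generalized CRFK-structure if and only if $(F_+,\gamma)$ and $(F_-,\gamma)$ are classical metric CRF-structures and the following conditions hold for any vector fields $X,Y,Z$ on $M$: $$\gamma(F_\pm X,(\nabla_ZF_\pm)(Y))=\pm\frac12\left[d\psi(F_\pm^2X,Y,Z)+d\psi(F_\pm X,F_\pm Y,Z)\right].$$
   Context: $M$ is a $C^\infty$ manifold, $T^{big}M=TM\oplus T^*M$ with $g((X,\alpha),(Y,\beta))=\frac12(\alpha(Y)+\beta(X))$ and Courant bracket $[(X,\alpha),(Y,\beta)]=([X,Y],L_X\beta-L_Y\alpha+\frac12 d(\alpha(Y)-\beta(X)))$, extended complex (bi)linearly. A generalized F-structure is a $g$-skew-symmetric endomorphism $\Phi$ of $T^{big}M$ with $\Phi^3+\Phi=0$; it is CRF if the sections of its $\sqrt{-1}$-eigenbundle $E\subseteq T^{big}M\otimes\mathbb{C}$ are closed under the Courant bracket; $S=\ker\Phi$. A generalized Riemannian metric is a positive definite metric $G$ on $T^{big}M$ such that $\sharp_G$ defined by $2g(\sharp_G\mathcal{X},\mathcal{Y})=G(\mathcal{X},\mathcal{Y})$ satisfies $\sharp_G^2=Id$ and preserves $g$. $G$ is equivalent to a pair $(\gamma,\psi)$ (Riemannian metric, $2$-form) such that the $(\pm1)$-eigenbundles of $\sharp_G$ are $V_\pm=\{(X,\flat_{\psi\pm\gamma}X)\,/\,X\in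 TM\}$, $\flat_\tau X=i(X)\tau$; $\tau_\pm=pr_{TM}|_{V_\pm}$ are isomorphisms onto $TM$. $(\Phi,G)$ is a generalized metric F-structure (metric CRF-structure, if $\Phi$ is CRF) if $G(\Phi\mathcal{X},\mathcal{Y})+G(\mathcal{X},\Phi\mathcal{Y})=0$; then $\Phi$ preserves $V_\pm$ and $F_\pm=\tau_\pm\circ\Phi|_{V_\pm}\circ\tau_\pm^{-1}$ satisfy $F_\pm^3+F_\pm=0$ and are $\gamma$-skew-symmetric. Put $E_\pm=V_\pm\cap E$, $S_\pm=V_\pm\cap S$ (bundles complexified as needed). $(\Phi,G)$ is a generalized CRFK-structure if $[E_\pm,E_\pm]\subseteq E_\pm$ and $[E_\pm,S_\pm]\subseteq E_\pm\oplus S_\pm$ (Courant brackets of sections, same sign throughout). $H_\pm,\bar H_\pm,Q_\pm$ are the eigenbundles of $F_\pm$ in $TM\otimes\mathbb{C}$ for the eigenvalues $\sqrt{-1},-\sqrt{-1},0$. $(F_\pm,\gamma)$ is a classical metric CRF-structure if, besides $F_\pm^3+F_\pm=0$ and $\gamma$-skew-symmetry, $[H_\pm,H_\pm]\subseteq H_\pm$ and $[H_\pm,Q_\pm]\subseteq H_\pm\oplus Q_\pm$ (Lie brackets). Every formula with $\pm$ stands for two formulas. *)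

(* Defs.v *)
From HB Require Import structures.
From mathcomp Require Import all_boot all_order all_algebra.
From mathcomp Require Import ring.
From mathcomp Require Import all_classical all_reals all_analysis.

Set Implicit Arguments.
Unset Strict Implicit.
Unset Printing Implicit Defensive.

Import Order.TTheory GRing.Theory Num.Theory.
Import numFieldNormedType.Exports.

Local Open Scope classical_set_scope.
Local Open Scope ring_scope.

(* All iterated directional derivatives exist and are continuous on U.  U is
   meant to be open, so the values of f outside U are irrelevant. *)
Definition smooth_on (R : realType) (n : nat) (W : normedModType R)
    (U : set 'rV[R]_n) (f : 'rV[R]_n -> W) : Prop :=
  forall (vs : seq 'rV[R]_n) (x : 'rV[R]_n), U x ->
    let D := foldl (fun h v => 'D_v h) f vs in
    {for x, continuous D} /\ forall v, derivable D x v.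

Section SmoothClosure.
Variables (R : realType) (n : nat).
Implicit Types (k : nat) (U : set 'rV[R]_n).

Let Ck k U (f : 'rV[R]_n -> R) : Prop :=
  forall (vs : seq 'rV[R]_n) x, (size vs <= k)%N -> U x ->
    let D := foldl (fun h v => 'D_v h) f vs in
    {for x, continuous D} /\ forall v, derivable D x v.

Let CkS k U f :
  (forall x, U x -> {for x, continuous f} /\ forall v, derivable f x v) ->
  (forall v, Ck k U ('D_v f)) -> Ck k.+1 U f.
Proof. by move=> df Df [|v vs] x /= sz Ux; [exact: df | exact: Df]. Qed.

Let CkD k U f v : Ck k.+1 U f -> Ck k U ('D_v f).
Proof. by move=> Cf vs x sz Ux; exact: (Cf (v :: vs)). Qed.

Let Ck0 k U f : Ck k U f ->
  forall x, U x -> {for x, continuous f} /\ forall v, derivable f x v.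
Proof. by move=> Cf x Ux; exact: (Cf [::]). Qed.

Let CkW k U f : Ck k.+1 U f -> Ck k U f.
Proof. by move=> Cf vs x sz; apply: Cf; rewrite (leq_trans sz). Qed.

Let CkP U f : smooth_on U f <-> forall k, Ck k U f.
Proof.
by split=> [sf k vs x _|Cf vs x]; [exact: sf | exact: (Cf (size vs))].
Qed.

Let near_open U (f g : 'rV[R]_n -> R) x :
  open U -> (forall y, U y -> f y = g y) -> U x -> {near x, f =1 g}.
Proof.
by move=> oU fg Ux; apply: (@filterS _ _ _ U) => //; exact: open_nbhs_nbhs.
Qed.

Let eq_point U (f g : 'rV[R]_n -> R) x :
  open U -> (forall y, U y -> f y = g y) -> U x ->
  {for x, continuous f} /\ (forall v, derivable f x v) ->
  {for x, continuous g} /\ (forall v, derivable g x v).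
Proof.
move=> oU fg Ux [cf df]; have nfg := near_open oU fg Ux; split.
  rewrite /prop_for /continuous_at -(fg _ Ux).
  exact: cvg_trans (near_eq_cvg nfg) cf.
by move=> v; apply: near_eq_derivable (df v).
Qed.

Let eq_Ck k U f g :
  open U -> (forall y, U y -> f y = g y) -> Ck k U f -> Ck k U g.
Proof.
move=> oU; elim: k f g => [|k IH] f g fg Cf.
  move=> vs x; rewrite leqn0 size_eq0 => /eqP -> Ux /=.
  by apply: (eq_point oU fg Ux); exact: Ck0 Cf _ Ux.
apply: CkS => [x Ux|v]; first by apply: (eq_point oU fg Ux); exact: Ck0 Cf _ Ux.
apply: IH (CkD v Cf) => y Uy; apply: near_eq_derive; exact: near_open fg Uy.
Qed.

Lemma smooth_on_cst U (c : R) : smooth_on U (cst c).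
Proof.
apply/CkP => k; elim: k c => [|k IH] c.
  move=> vs x; rewrite leqn0 size_eq0 => /eqP -> Ux /=.
  by split=> [|v]; [exact: cst_continuous | exact: derivable_cst].
apply: CkS => [x _|v].
  by split=> [|v]; [exact: cst_continuous | exact: derivable_cst].
rewrite (_ : 'D_v _ = cst 0) //; apply/funext => x; exact: derive_cst.
Qed.

Let pointD (f g : 'rV[R]_n -> R) x :
  {for x, continuous f} /\ (forall v, derivable f x v) ->
  {for x, continuous g} /\ (forall v, derivable g x v) ->
  {for x, continuous (f + g)} /\ (forall v, derivable (f + g) x v).
Proof.
by move=> [cf df] [cg dg]; split=> [|v]; [exact: continuousD | exact: derivableD].
Qed.

Let pointM (f g : 'rV[R]_n -> R) x :
  {for x, continuous f} /\ (forall v, derivable f x v) ->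
  {for x, continuous g} /\ (forall v, derivable g x v) ->
  {for x, continuous (f * g)} /\ (forall v, derivable (f * g) x v).
Proof.
by move=> [cf df] [cg dg]; split=> [|v]; [exact: continuousM | exact: derivableM].
Qed.

Let CkDD k U f g : open U -> Ck k U f -> Ck k U g -> Ck k U (f + g).
Proof.
move=> oU; elim: k f g => [|k IH] f g Cf Cg.
  move=> vs x; rewrite leqn0 size_eq0 => /eqP -> Ux /=.
  by apply: pointD; [exact: Ck0 Cf _ Ux | exact: Ck0 Cg _ Ux].
apply: CkS => [x Ux|v].
  by apply: pointD; [exact: Ck0 Cf _ Ux | exact: Ck0 Cg _ Ux].
apply: eq_Ck (IH _ _ (CkD v Cf) (CkD v Cg)) => // y Uy.
by rewrite deriveD //; [case: (Ck0 Cf Uy) | case: (Ck0 Cg Uy)].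
Qed.

Let CkM k U f g : open U -> Ck k U f -> Ck k U g -> Ck k U (f * g).
Proof.
move=> oU; elim: k f g => [|k IH] f g Cf Cg.
  move=> vs x; rewrite leqn0 size_eq0 => /eqP -> Ux /=.
  by apply: pointM; [exact: Ck0 Cf _ Ux | exact: Ck0 Cg _ Ux].
apply: CkS => [x Ux|v].
  by apply: pointM; [exact: Ck0 Cf _ Ux | exact: Ck0 Cg _ Ux].
apply: (@eq_Ck _ _ (f * 'D_v g + g * 'D_v f)) => //; last first.
  by apply: CkDD => //; apply: IH; first [exact: CkW | exact: CkD].
move=> y Uy; rewrite deriveM //; [by case: (Ck0 Cf Uy) | by case: (Ck0 Cg Uy)].
Qed.

Lemma smooth_onD U (f g : 'rV[R]_n -> R) : open U ->
  smooth_on U f -> smooth_on U g -> smooth_on U (f + g).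
Proof. by move=> oU /CkP Cf /CkP Cg; apply/CkP => k; exact: CkDD. Qed.

Lemma smooth_onM U (f g : 'rV[R]_n -> R) : open U ->
  smooth_on U f -> smooth_on U g -> smooth_on U (f * g).
Proof. by move=> oU /CkP Cf /CkP Cg; apply/CkP => k; exact: CkM. Qed.

End SmoothClosure.

(* chart_inv is only meaningful on the open image chart_fun @` chart_dom *)
Record chart (R : realType) (n : nat) (M : topologicalType) := Chart {
  chart_dom : set M;
  chart_fun :> M -> 'rV[R]_n;
  chart_inv : 'rV[R]_n -> M;
  chart_dom_open : open chart_dom;
  chart_cod_open : open (chart_fun @` chart_dom);
  chart_funK : {in chart_dom, cancel chart_fun chart_inv};
  chart_fun_continuous : {within chart_dom, continuous chart_fun};
  chart_inv_continuous :
    {within chart_fun @` chart_dom, continuous chart_inv}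
}.

Definition smoothly_compatible (R : realType) n (M : topologicalType)
    (c c' : chart R n M) : Prop :=
  smooth_on (c @` (chart_dom c `&` chart_dom c')) (c' \o chart_inv c).

Record manifold (R : realType) (n : nat) := Manifold {
  manifold_sort :> topologicalType;
  manifold_hausdorff : hausdorff_space manifold_sort;
  manifold_second_countable : @second_countable manifold_sort;
  atlas : set (chart R n manifold_sort);
  atlas_cover : forall p, exists2 c, atlas c & chart_dom c p;
  atlas_compatible : forall c c', atlas c -> atlas c' ->
    smoothly_compatible c c'
}.

Section SmoothFunctions.
Variables (R : realType) (n : nat) (M : manifold R n).

Definition smooth_fun : {pred M -> R} := fun f =>
  `[< forall c, atlas c -> smooth_on (c @` chart_dom c) (f \o chart_inv c) >].

Record Cinf := MkCinf { Cinf_fun :> M -> R; CinfP : Cinf_fun \in smooth_fun }.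

Let smooth_funP (f : M -> R) : f \in smooth_fun <->
  forall c, atlas c -> smooth_on (c @` chart_dom c) (f \o chart_inv c).
Proof. by split=> [/asboolP|?] //; apply/asboolP. Qed.

Lemma smooth_fun_cst (c : R) : (cst c : M -> R) \in smooth_fun.
Proof. by apply/smooth_funP => ? _; exact: smooth_on_cst. Qed.

Lemma smooth_fun_subring : subring_closed smooth_fun.
Proof.
have D (f g : M -> R) :
    f \in smooth_fun -> g \in smooth_fun -> f + g \in smooth_fun.
  move=> /smooth_funP sf /smooth_funP sg; apply/smooth_funP => c ac.
  by apply: smooth_onD (sf _ ac) (sg _ ac); exact: chart_cod_open.
have P (f g : M -> R) :
    f \in smooth_fun -> g \in smooth_fun -> f * g \in smooth_fun.
  move=> /smooth_funP sf /smooth_funP sg; apply/smooth_funP => c ac.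
  by apply: smooth_onM (sf _ ac) (sg _ ac); exact: chart_cod_open.
split; [exact: (smooth_fun_cst 1) | move=> f g sf sg | exact: P].
apply: D; first exact: sf.
by rewrite -mulN1r; apply: P; [exact: (smooth_fun_cst (-1)) | exact: sg].
Qed.

HB.instance Definition _ := [isSub for Cinf_fun].
HB.instance Definition _ := [Choice of Cinf by <:].
HB.instance Definition _ :=
  GRing.SubChoice_isSubComPzRing.Build (M -> R) smooth_fun Cinf
    smooth_fun_subring.

Definition scst (a : R) : Cinf := MkCinf (smooth_fun_cst a).

End SmoothFunctions.

(* A vector field is a derivation of the ring of smooth functions, i.e. a
   family of derivations at the points of M mapping smooth functions to smooth
   functions.  From here on a tensor field, resp. a bundle morphism, is a
   C^oo(M)-multilinear map, resp. a C^oo(M)-linear map, between modules of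
   global smooth sections. *)
Section VectorFields.
Variables (R : realType) (n : nat) (M : manifold R n).
Local Notation Cinf := (Cinf M).
Implicit Types (f g : Cinf).

Definition derivation : {pred Cinf -> Cinf^o} := fun D =>
  `[< (forall (a : R) f g,
         D (scst M a * f + g) = scst M a * D f + D g :> Cinf) /\
      (forall f g, D (f * g) = D f * g + f * D g :> Cinf) >].

Record vfield := MkVfield {
  vfield_fun :> Cinf -> Cinf^o;
  vfieldP : vfield_fun \in derivation
}.

Lemma derivationP (D : Cinf -> Cinf^o) :
  reflect ((forall (a : R) f g,
              D (scst M a * f + g) = scst M a * D f + D g :> Cinf) /\
           (forall f g, D (f * g) = D f * g + f * D g :> Cinf))
          (D \in derivation).
Proof. exact: asboolP. Qed.

Lemma derivation_subsemimod : GRing.subsemimod_closed derivation.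
Proof.
split; first split.
- apply/derivationP; split=> [a f g|f g]; rewrite /GRing.zero /=.
    by rewrite mulr0 addr0.
  by rewrite mul0r mulr0 addr0.
- move=> D D' /derivationP[D1 D2] /derivationP[D1' D2'].
  apply/derivationP; split=> [a f g|f g].
    change (D (scst M a * f + g) + D' (scst M a * f + g) =
      scst M a * (D f + D' f) + (D g + D' g) :> Cinf).
    by rewrite D1 D1' mulrDr addrACA.
  change (D (f * g) + D' (f * g) = (D f + D' f) * g + f * (D g + D' g) :> Cinf).
  by rewrite D2 D2' mulrDl mulrDr addrACA.
- move=> h D /derivationP[D1 D2]; apply/derivationP; split=> [a f g|f g].
    change (h * D (scst M a * f + g) =
      scst M a * (h * D f) + h * D g :> Cinf).
    by rewrite D1 mulrDr mulrCA.
  change (h * D (f * g) = h * D f * g + f * (h * D g) :> Cinf).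
  by rewrite D2 mulrDr mulrA [f * (h * _)]mulrCA.
Qed.

HB.instance Definition _ := [isSub for vfield_fun].
HB.instance Definition _ := [Choice of vfield by <:].
HB.instance Definition _ :=
  GRing.SubChoice_isSubLmodule.Build Cinf (Cinf -> Cinf^o) derivation vfield
    derivation_subsemimod.

Implicit Types (X Y Z : vfield).

Lemma vfieldD X f g : X (f + g) = X f + X g :> Cinf.
Proof.
have /derivationP[XD _] := vfieldP X.
have scst1 : scst M 1 = 1 by exact/val_inj.
by have := XD 1 f g; rewrite scst1 !mul1r.
Qed.

Lemma vfieldZ X (a : R) f : X (scst M a * f) = scst M a * X f :> Cinf.
Proof.
have /derivationP[XD _] := vfieldP X.
have X0 : X 0 = 0 :> Cinf.
  by apply: (addrI (X 0 : Cinf)); rewrite -vfieldD !addr0.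
by have := XD a f 0; rewrite X0 !addr0.
Qed.

Lemma vfieldM X f g : X (f * g) = X f * g + f * X g :> Cinf.
Proof. by have /derivationP[_ ->] := vfieldP X. Qed.

Lemma vfieldB X f g : X (f - g) = X f - X g :> Cinf.
Proof. by apply/eqP; rewrite eq_sym subr_eq -vfieldD subrK. Qed.

Lemma lie_subproof X Y :
  (fun f => X (Y f : Cinf) - Y (X f : Cinf)) \in derivation.
Proof.
apply/derivationP; split=> [a f g|f g].
  by rewrite !(vfieldD, vfieldZ) mulrBr opprD addrACA.
rewrite !(vfieldM, vfieldD); move: (X (Y f : Cinf)) (Y (X f : Cinf)) => a b.
by move: (X f) (Y f) (X g) (Y g) (X (Y g : Cinf)) (Y (X g : Cinf)) => *; ring.
Qed.

Definition lie X Y : vfield := MkVfield (lie_subproof X Y).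

Lemma lie_linearr X (f : Cinf) Y Z :
  lie X (f *: Y + Z) = f *: lie X Y + X f *: Y + lie X Z.
Proof.
apply/val_inj/funext => h.
change (X (f * Y h + Z h) - (f * Y (X h : Cinf) + Z (X h : Cinf)) =
  f * (X (Y h : Cinf) - Y (X h : Cinf)) + X f * Y h +
  (X (Z h : Cinf) - Z (X h : Cinf)) :> Cinf).
rewrite vfieldD vfieldM.
move: (X (Y h : Cinf)) (Y (X h : Cinf)) (X (Z h : Cinf)) (Z (X h : Cinf)).
by move: (X f) (Y h) => * /=; ring.
Qed.

End VectorFields.

Section OneForms.
Variables (R : realType) (n : nat) (M : manifold R n).
Local Notation Cinf := (Cinf M).
Local Notation vfield := (vfield M).
Implicit Types (f : Cinf) (X Y Z : vfield).

Definition is_form1 : {pred vfield -> Cinf^o} := fun alpha =>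
  `[< forall f X Y, alpha (f *: X + Y) = f * alpha X + alpha Y :> Cinf >].

Record form1 := MkForm1 {
  form1_fun :> vfield -> Cinf^o;
  form1P : form1_fun \in is_form1
}.

Lemma is_form1P (alpha : vfield -> Cinf^o) :
  reflect (forall f X Y, alpha (f *: X + Y) = f * alpha X + alpha Y :> Cinf)
          (alpha \in is_form1).
Proof. exact: asboolP. Qed.

Lemma is_form1_subsemimod : GRing.subsemimod_closed is_form1.
Proof.
split; first split.
- by apply/is_form1P => f X Y; rewrite /GRing.zero /= mulr0 addr0.
- move=> a b /is_form1P la /is_form1P lb; apply/is_form1P => f X Y.
  change (a (f *: X + Y) + b (f *: X + Y) =
    f * (a X + b X) + (a Y + b Y) :> Cinf).
  by rewrite la lb mulrDr addrACA.
- move=> h a /is_form1P la; apply/is_form1P => f X Y.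
  change (h * a (f *: X + Y) = f * (h * a X) + h * a Y :> Cinf).
  by rewrite la mulrDr mulrCA.
Qed.

HB.instance Definition _ := [isSub for form1_fun].
HB.instance Definition _ := [Choice of form1 by <:].
HB.instance Definition _ :=
  GRing.SubChoice_isSubLmodule.Build Cinf (vfield -> Cinf^o) is_form1 form1
    is_form1_subsemimod.

Implicit Types (alpha : form1).

Lemma form1_linear alpha f X Y :
  alpha (f *: X + Y) = f * alpha X + alpha Y :> Cinf.
Proof. by move: (form1P alpha) => /is_form1P. Qed.

Lemma dfun_subproof f : (fun X => X f) \in is_form1.
Proof. by apply/is_form1P. Qed.

Definition dfun f : form1 := MkForm1 (dfun_subproof f).

Lemma lie_form_subproof X alpha :
  (fun Z => X (alpha Z : Cinf) - alpha (lie X Z)) \in is_form1.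
Proof.
apply/is_form1P => f Y Z.
rewrite lie_linearr -addrA !form1_linear vfieldD vfieldM.
move: (X f) (alpha Y) (alpha Z) (alpha (lie X Y)) (alpha (lie X Z)).
by move: (X (alpha Y : Cinf)) (X (alpha Z : Cinf)) => *; ring.
Qed.

Definition lie_form X alpha : form1 := MkForm1 (lie_form_subproof X alpha).

End OneForms.

Section Bilinear.
Variables (R : realType) (n : nat) (M : manifold R n) (V : lmodType (Cinf M)).

Definition is_bilin (b : V -> V -> Cinf M) : Prop :=
  (forall f u v w, b (f *: u + v) w = f * b u w + b v w) /\
  (forall f u v w, b u (f *: v + w) = f * b u v + b u w).

Record bilin := MkBilin {
  bilin_fun :> V -> V -> Cinf M;
  bilinP : is_bilin bilin_fun
}.

Definition symmetric_bilin (b : bilin) : Prop := forall u v, b u v = b v u.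
Definition alternating_bilin (b : bilin) : Prop := forall u, b u u = 0.

End Bilinear.

Notation cplx V := (V * V)%type.

(* (u, v) : cplx V stands for u + sqrt(-1) v. *)
Section Complexification.
Variables (R : realType) (n : nat) (M : manifold R n).
Variables (V : lmodType (Cinf M)).

Definition imul (x : cplx V) : cplx V := (- x.2, x.1).

Definition cmap (f : V -> V) (x : cplx V) : cplx V := (f x.1, f x.2).

Definition cbracket (br : V -> V -> V) (x y : cplx V) : cplx V :=
  (br x.1 y.1 - br x.2 y.2, br x.1 y.2 + br x.2 y.1).

Definition eigen_i (f : V -> V) : set (cplx V) := [set x | cmap f x = imul x].
Definition eigen_0 (f : V -> V) : set (cplx V) := [set x | cmap f x = 0].

Definition bracket_sub (br : V -> V -> V) (A B C : set (cplx V)) : Prop :=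
  forall x y, A x -> B y -> C (cbracket br x y).

Definition sumset (A B : set (cplx V)) : set (cplx V) :=
  [set x + y | x in A & y in B].

End Complexification.

Section GeneralizedGeometry.
Variables (R : realType) (n : nat) (M : manifold R n).
Local Notation Cinf := (Cinf M).
Local Notation vfield := (vfield M).
Local Notation form1 := (form1 M).

Definition Tbig : Type := (vfield * form1)%type.
HB.instance Definition _ := GRing.Lmodule.on Tbig.

Definition gpair (x y : Tbig) : Cinf := scst M 2^-1 * (x.2 y.1 + y.2 x.1).

Definition courant (x y : Tbig) : Tbig :=
  (lie x.1 y.1,
   lie_form x.1 y.2 - lie_form y.1 x.2 +
     scst M 2^-1 *: dfun (x.2 y.1 - y.2 x.1 : Cinf)).

Definition vfield_zero_at (X : vfield) (p : M) : Prop :=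
  forall f : Cinf, (X f : Cinf) p = 0.
Definition Tbig_zero_at (x : Tbig) (p : M) : Prop :=
  vfield_zero_at x.1 p /\ forall Y : vfield, (x.2 Y : Cinf) p = 0.

Definition riemannian (gamma : bilin vfield) : Prop :=
  symmetric_bilin gamma /\
  forall X p, ~ vfield_zero_at X p -> 0 < gamma X X p.

(* gm_sharp is determined by gm_form. *)
Record gen_metric := MkGenMetric {
  gm_form :> bilin Tbig;
  gm_sharp : {linear Tbig -> Tbig};
  gm_sym : symmetric_bilin gm_form;
  gm_pos : forall x p, ~ Tbig_zero_at x p -> 0 < gm_form x x p;
  gm_sharpE : forall x y, 2%:R * gpair (gm_sharp x) y = gm_form x y;
  gm_sharpK : forall x, gm_sharp (gm_sharp x) = x;
  gm_sharp_isom : forall x y, gpair (gm_sharp x) (gm_sharp y) = gpair x y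
}.

(* A double sign is a boolean s: (-1) ^+ s is +1 for s = false, -1 for
   s = true. *)
Definition Vpm (G : gen_metric) (s : bool) : set Tbig :=
  [set x | gm_sharp G x = (-1) ^+ s *: x].

Lemma flat_subproof (tau : bilin vfield) (X : vfield) :
  (tau X : vfield -> Cinf^o) \in @is_form1 _ _ M.
Proof. by apply/is_form1P => f Y Z; case: (bilinP tau) => _ ->. Qed.

Definition flat (tau : bilin vfield) (X : vfield) : form1 :=
  MkForm1 (flat_subproof tau X).

Section Structures.
Variables (Phi : {linear Tbig -> Tbig}) (G : gen_metric).
Variables (gamma psi : bilin vfield).

Definition lift_pm (s : bool) (X : vfield) : Tbig :=
  (X, flat psi X + (-1) ^+ s *: flat gamma X).

Definition associated_pair : Prop :=
  riemannian gamma /\ alternating_bilin psi /\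
  forall s, Vpm G s = range (lift_pm s).

Definition gen_F_structure : Prop :=
  (forall x y, gpair (Phi x) y + gpair x (Phi y) = 0) /\
  (forall x, Phi (Phi (Phi x)) + Phi x = 0).

Definition E_bundle : set (cplx Tbig) := eigen_i Phi.
Definition S_bundle : set (cplx Tbig) := eigen_0 Phi.
Definition Vpm_cplx (s : bool) : set (cplx Tbig) :=
  [set x | Vpm G s x.1 /\ Vpm G s x.2].

Definition gen_metric_CRF : Prop :=
  [/\ gen_F_structure,
      forall x y, G (Phi x) y + G x (Phi y) = 0 &
      bracket_sub courant E_bundle E_bundle E_bundle].

Definition gen_CRFK : Prop :=
  gen_metric_CRF /\
  forall s, let Es := Vpm_cplx s `&` E_bundle in
            let Ss := Vpm_cplx s `&` S_bundle in
    bracket_sub courant Es Es Es /\ bracket_sub courant Es Ss (sumset Es Ss).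

(* lift_pm s is the inverse of the projection of V_s onto TM. *)
Definition Fpm (s : bool) (X : vfield) : vfield := (Phi (lift_pm s X)).1.

End Structures.

Definition classical_metric_CRF (F : vfield -> vfield) (gamma : bilin vfield)
    : Prop :=
  [/\ linear F,
      forall X, F (F (F X)) + F X = 0,
      forall X Y, gamma (F X) Y + gamma X (F Y) = 0,
      bracket_sub (@lie _ _ M) (eigen_i F) (eigen_i F) (eigen_i F) &
      bracket_sub (@lie _ _ M) (eigen_i F) (eigen_0 F)
        (sumset (eigen_i F) (eigen_0 F))].

Definition levi_civita (gamma : bilin vfield)
    (nabla : vfield -> vfield -> vfield) : Prop :=
  [/\ forall (f : Cinf) (X Y Z : vfield),
        nabla (f *: X + Y) Z = f *: nabla X Z + nabla Y Z,
      forall (f : Cinf) (X Y Z : vfield),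
        nabla X (f *: Y + Z) =
          f *: nabla X Y + (X f : Cinf) *: Y + nabla X Z,
      forall X Y, nabla X Y - nabla Y X = lie X Y &
      forall X Y Z : vfield,
        X (gamma Y Z) = gamma (nabla X Y) Z + gamma Y (nabla X Z) :> Cinf].

Definition nabla_endo (nabla : vfield -> vfield -> vfield)
    (Z : vfield) (F : vfield -> vfield) (Y : vfield) : vfield :=
  nabla Z (F Y) - F (nabla Z Y).

Definition d2form (psi : bilin vfield) (X Y Z : vfield) : Cinf :=
  (X (psi Y Z) : Cinf) - (Y (psi X Z) : Cinf) + (Z (psi X Y) : Cinf)
  - psi (lie X Y) Z + psi (lie X Z) Y - psi (lie Y Z) X.

End GeneralizedGeometry.

(* Main.v *)
(** The lifts [X |-> (X, flat_(psi +- gamma) X)] identify [TM] with [V_+-] and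
    intertwine [F_+-] with [Phi].  They respect brackets up to the 1-form
    [W(X, Y) Z = dpsi(X, Y, Z) +- (gamma(Y, nabla_Z X) - gamma(X, nabla_Z Y))],
    so the CRFK conditions say that [(F_+-, gamma)] is classical CRF and that
    [W] vanishes on [H x (H + Q)].  As [F^2 X + i F X] runs over [H] and [Y - i F Y]
    over [H + Q], the latter means [W(F^2 X, Y) + W(F X, F Y) = 0], and
    skew-symmetry of [F] together with [nabla gamma = 0] turns this into the
    stated formula. *)
From HB Require Import structures.
Require Import Defs.
From mathcomp Require Import all_boot all_order all_algebra.
From mathcomp Require Import ring.
From mathcomp Require Import all_classical all_reals all_analysis.
Import GRing.Theory Num.Theory.
Local Open Scope ring_scope.

Set Implicit Arguments.
Unset Strict Implicit.
Unset Printing Implicit Defensive.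

(** * Elementary identities for fields, bilinear forms and the pairing [g] *)

Section Tensors.
Variables (R : realType) (n : nat) (M : manifold R n).
Local Notation Cinf := (Cinf M).
Local Notation vfield := (vfield M).
Local Notation form1 := (form1 M).

Lemma scst_half : scst M 2^-1 + scst M 2^-1 = 1 :> Cinf.
Proof.
apply/val_inj/funext => p.
change (2^-1 + 2^-1 = 1 :> R).
by rewrite -mulr2n -[_ *+ 2]mulr_natr mulVf // pnatr_eq0.
Qed.

Lemma half_inj : injective ( *%R (scst M 2^-1)).
Proof.
move=> f g fg; rewrite -[f]mul1r -[g]mul1r -scst_half !mulrDl.
by congr (_ + _).
Qed.

Section Bilin.
Variables (V : lmodType Cinf) (b : bilin V).

Lemma bilinDl u v w : b (u + v) w = b u w + b v w.
Proof. by have := (bilinP b).1 1 u v w; rewrite scale1r mul1r. Qed.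

Lemma bilinDr u v w : b w (u + v) = b w u + b w v.
Proof. by have := (bilinP b).2 1 w u v; rewrite scale1r mul1r. Qed.

Lemma bilin0l u : b 0 u = 0.
Proof. by apply: (addrI (b 0 u)); rewrite -bilinDl !addr0. Qed.

Lemma bilin0r u : b u 0 = 0.
Proof. by apply: (addrI (b u 0)); rewrite -bilinDr !addr0. Qed.

Lemma bilinNl u v : b (- u) v = - b u v.
Proof. by apply: (addrI (b u v)); rewrite -bilinDl !subrr bilin0l. Qed.

Lemma bilinNr u v : b u (- v) = - b u v.
Proof. by apply: (addrI (b u v)); rewrite -bilinDr !subrr bilin0r. Qed.

Lemma alternating_bilinC : alternating_bilin b -> forall u v, b u v = - b v u.
Proof.
move=> alt u v; apply/eqP; rewrite -addr_eq0; apply/eqP.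
by have := alt (u + v); rewrite bilinDl !bilinDr !alt add0r addr0.
Qed.

End Bilin.

Implicit Types (X Y Z : vfield).

Lemma vfieldN X (f : Cinf) : X (- f) = - (X f : Cinf) :> Cinf.
Proof.
have X0 : X 0 = 0 :> Cinf by have := vfieldB X 0 0; rewrite !subrr.
by rewrite -[- f]sub0r vfieldB X0 sub0r.
Qed.

Lemma vfield1 X : X 1 = 0 :> Cinf.
Proof.
apply: (addrI (X 1 : Cinf)).
by have := vfieldM X 1 1; rewrite !mulr1 mul1r addr0 => <-.
Qed.

Lemma lieDr X Y Z : lie X (Y + Z) = lie X Y + lie X Z.
Proof.
by have := lie_linearr X 1 Y Z; rewrite vfield1 !scale1r scale0r addr0.
Qed.

Lemma lieDl X Y Z : lie (X + Y) Z = lie X Z + lie Y Z.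
Proof.
apply/val_inj/funext => f.
change ((X (Z f) : Cinf) + Y (Z f) - (Z (X f + Y f) : Cinf) =
  ((X (Z f) : Cinf) - Z (X f)) + ((Y (Z f) : Cinf) - Z (Y f)) :> Cinf).
by rewrite vfieldD opprD addrACA.
Qed.

Lemma form1_0 (a : form1) : a 0 = 0 :> Cinf.
Proof.
apply: (addrI (a 0 : Cinf)).
by have := form1_linear a 1 0 0; rewrite scale1r mul1r !addr0 => <-.
Qed.

Lemma gpairB (x y z : Tbig M) : gpair (x - y) z = gpair x z - gpair y z.
Proof.
have := form1_linear z.2 (-1) y.1 x.1; rewrite scaleN1r addrC => zxy.
change (scst M 2^-1 * ((x.2 z.1 - y.2 z.1) + z.2 (x.1 - y.1)) =
  scst M 2^-1 * (x.2 z.1 + z.2 x.1) -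
  scst M 2^-1 * (y.2 z.1 + z.2 y.1) :> Cinf).
rewrite zxy.
move: (scst _ _) (x.2 z.1) (y.2 z.1) (z.2 x.1) (z.2 y.1) => *; ring.
Qed.

(** Pairing with [(0, dfun f)] recovers [x.1 f] and pairing with [(Y, 0)] recovers [x.2 Y], up to
    the factor 1/2; these values determine the section. *)
Lemma gpair_nondegenerate (x : Tbig M) : (forall y, gpair x y = 0) -> x = 0.
Proof.
move=> x0.
have x0' (y : Tbig M) : x.2 y.1 + y.2 x.1 = 0 :> Cinf.
  by apply: half_inj; rewrite mulr0; exact: x0.
have x1 : x.1 = 0.
  apply/val_inj/funext => f.
  by have := x0' (0, dfun f); rewrite /= form1_0 add0r.
have x2 : x.2 = 0.
  by apply/val_inj/funext => Y; have := x0' (Y, 0); rewrite /= addr0.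
by rewrite [x]surjective_pairing x1 x2.
Qed.

End Tensors.

(** * Courant brackets of lifts and their defect [W] *)

Section Lift.
Variables (R : realType) (n : nat) (M : manifold R n).
Local Notation Cinf := (Cinf M).
Local Notation vfield := (vfield M).
Variables (gamma psi : bilin vfield).
Implicit Types (X Y Z : vfield) (s : bool).

Local Notation lift := (lift_pm gamma psi).

Lemma lift_pm_is_linear s : linear (lift s).
Proof.
move=> f X Y; congr (_, _).
apply/val_inj/funext => Z.
change (psi (f *: X + Y) Z + (-1) ^+ s * gamma (f *: X + Y) Z =
  f * (psi X Z + (-1) ^+ s * gamma X Z) +
    (psi Y Z + (-1) ^+ s * gamma Y Z) :> Cinf).
rewrite (bilinP psi).1 (bilinP gamma).1.
move: ((-1) ^+ s) (psi X Z) (psi Y Z) (gamma X Z) (gamma Y Z) => *; ring.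
Qed.

HB.instance Definition _ s :=
  GRing.isLinear.Build Cinf vfield (Tbig M) _ (lift s) (lift_pm_is_linear s).

Variable nabla : vfield -> vfield -> vfield.
Hypotheses (gammaC : symmetric_bilin gamma) (psi0 : alternating_bilin psi).
Hypothesis LC : levi_civita gamma nabla.

(* The obstruction, evaluated on [Z], to [lift s] being a bracket morphism. *)
Definition lift_defect s X Y Z : Cinf :=
  d2form psi X Y Z + (-1) ^+ s * (gamma Y (nabla Z X) - gamma X (nabla Z Y)).

(** Only the 1-form parts need comparing, since the vector part is [lie X Y] by definition. The
    [psi] terms are those of [d2form] without [psi (lie X Y) Z]. In the [gamma] terms, metricity and
    zero torsion replace derivatives and brackets by [nabla], and the terms with [nabla X Z] and
    [nabla Y Z] cancel. *)
Lemma courant_lift s X Y Z :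
  (courant (lift s X) (lift s Y)).2 Z =
  ((lift s (lie X Y)).2 Z : Cinf) + lift_defect s X Y Z.
Proof.
case: LC => _ _ torsion metric.
have psiC := alternating_bilinC psi0.
(* In the exact term of the Courant bracket [gamma] drops out by symmetry, and [psi] appears twice,
   which absorbs the factor 1/2. *)
have psiXY : psi X Y + (-1) ^+ s * gamma X Y -
    (psi Y X + (-1) ^+ s * gamma Y X) = psi X Y + psi X Y.
  rewrite (psiC Y X) (gammaC Y X).
  by move: ((-1) ^+ s) (psi X Y) (gamma X Y) => *; ring.
have sgnZ (V : vfield) (g : Cinf) :
    V ((-1) ^+ s * g) = (-1) ^+ s * (V g : Cinf) :> Cinf.
  case: s {psiXY}; rewrite ?expr1 ?expr0 ?mulN1r ?mul1r //.
  exact: vfieldN.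
change (
  ((X (psi Y Z + (-1) ^+ s * gamma Y Z) : Cinf)
    - (psi Y (lie X Z) + (-1) ^+ s * gamma Y (lie X Z)))
  - ((Y (psi X Z + (-1) ^+ s * gamma X Z) : Cinf)
    - (psi X (lie Y Z) + (-1) ^+ s * gamma X (lie Y Z)))
  + scst M 2^-1 * (Z (psi X Y + (-1) ^+ s * gamma X Y -
    (psi Y X + (-1) ^+ s * gamma Y X)) : Cinf)
  = psi (lie X Y) Z + (-1) ^+ s * gamma (lie X Y) Z + lift_defect s X Y Z
  :> Cinf).
rewrite psiXY !vfieldD !sgnZ /lift_defect /d2form.
rewrite [scst _ _ * _](_ : _ = Z (psi X Y)); last first.
  by rewrite mulrDr -mulrDl scst_half mul1r.
rewrite (psiC Y (lie X Z)) (psiC X (lie Y Z)) !metric -!torsion.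
rewrite !(bilinDl gamma, bilinDr gamma, bilinNl gamma, bilinNr gamma).
rewrite (gammaC (nabla Y X) Z) (gammaC (nabla X Y) Z).
rewrite (gammaC Z (nabla Y X)) (gammaC Z (nabla X Y)).
move: ((-1) ^+ s) (gamma (nabla X Y) Z) (gamma (nabla Y X) Z).
move: (gamma Y (nabla X Z)) (gamma Y (nabla Z X)) => *.
ring.
Qed.

(** Function-linearity fails here: [nabla Z (f *: Y)] contributes a multiple of [Z f * gamma X Y].
    Additivity is enough for splitting an argument along [H] and [Q]. *)
Lemma lift_defectDr s X Y Y' Z :
  lift_defect s X (Y + Y') Z = lift_defect s X Y Z + lift_defect s X Y' Z.
Proof.
case: LC => nablaP nablaM _ _.
have nablaDl : nabla Z (Y + Y') = nabla Z Y + nabla Z Y'.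
  by have := nablaM 1 Z Y Y'; rewrite vfield1 !scale1r scale0r addr0.
rewrite /lift_defect /d2form nablaDl lieDr lieDl.
rewrite !(bilinDl gamma, bilinDr gamma, bilinDl psi, bilinDr psi) !vfieldD.
change ((Y + Y') (psi X Z)) with (Y (psi X Z) + Y' (psi X Z) : Cinf).
move: ((-1) ^+ s) (gamma Y (nabla Z X)) (gamma Y' (nabla Z X)).
move: (gamma X (nabla Z Y)) (gamma X (nabla Z Y')).
move: (X (psi Y Z)) (X (psi Y' Z)) (Y (psi X Z)) (Y' (psi X Z)).
move: (Z (psi X Y)) (Z (psi X Y')) (psi (lie X Y) Z) (psi (lie X Y') Z).
move: (psi (lie X Z) Y) (psi (lie X Z) Y').
move: (psi (lie Y Z) X) (psi (lie Y' Z) X) => *; ring.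
Qed.

Lemma lift_defect0r s X Z : lift_defect s X 0 Z = 0.
Proof.
by apply: (addrI (lift_defect s X 0 Z)); rewrite -lift_defectDr !addr0.
Qed.

Lemma lift_defectNr s X Y Z : lift_defect s X (- Y) Z = - lift_defect s X Y Z.
Proof.
apply: (addrI (lift_defect s X Y Z)).
by rewrite -lift_defectDr !subrr lift_defect0r.
Qed.

(** The alternating [psi] cancels in the symmetric pairing. Through this identity [g]-skewness of
    [Phi] becomes [gamma]-skewness of [F]. *)
Lemma gpair_lift s X Y : gpair (lift s X) (lift s Y) = (-1) ^+ s * gamma X Y.
Proof.
change (scst M 2^-1 * ((psi X Y + (-1) ^+ s * gamma X Y) +
  (psi Y X + (-1) ^+ s * gamma Y X)) = (-1) ^+ s * gamma X Y :> Cinf).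
rewrite (alternating_bilinC psi0 Y X) (gammaC Y X).
rewrite [X in _ * X](_ : _ = (-1) ^+ s * gamma X Y + (-1) ^+ s * gamma X Y).
  by rewrite mulrDr -mulrDl scst_half mul1r.
by move: ((-1) ^+ s) (psi X Y) (gamma X Y) => *; ring.
Qed.

(** Differentiating [gamma Y (F (F X)) = - gamma (F Y) (F X)] along [Z] eliminates the derivatives
    of [F (F X)] and [F X]. What survives is twice the pairing of [F X] with the derivative of [F]
    at [Y]. *)
Lemma lift_defect_nabla s (F : vfield -> vfield) X Y Z :
  (forall U V, gamma (F U) V + gamma U (F V) = 0) ->
  lift_defect s (F (F X)) Y Z + lift_defect s (F X) (F Y) Z =
  d2form psi (F (F X)) Y Z + d2form psi (F X) (F Y) Z -
  (-1) ^+ s * (gamma (F X) (nabla_endo nabla Z F Y) +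
               gamma (F X) (nabla_endo nabla Z F Y)).
Proof.
move=> skew; case: LC => _ _ _ metric.
have {}skew U V : gamma U (F V) = - gamma (F U) V.
  by apply/eqP; rewrite -addr_eq0 addrC skew.
have m1 := metric Z Y (F (F X)); have m2 := metric Z (F Y) (F X).
have ZN : Z (- gamma (F Y) (F X)) = - (Z (gamma (F Y) (F X)) : Cinf) :> Cinf.
  exact: vfieldN.
move: m1; rewrite skew ZN m2 => m1.
rewrite /lift_defect /nabla_endo bilinDr bilinNr skew opprK.
have -> : gamma Y (nabla Z (F (F X))) =
    - gamma (nabla Z (F Y)) (F X) - gamma (F Y) (nabla Z (F X))
    - gamma (nabla Z Y) (F (F X)) by rewrite -opprD m1 [X in X - _]addrC addrK.
rewrite (gammaC (nabla Z (F Y))) (gammaC (nabla Z Y)).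
move: ((-1) ^+ s) (d2form _ _ _ _) (d2form _ _ _ _).
move: (gamma _ _) (gamma _ _) (gamma _ _) => *; ring.
Qed.

End Lift.

(** * Transport of [Phi] and its eigenbundles from [V_+-] to [TM] *)

Section Associated.
Variables (R : realType) (n : nat) (M : manifold R n).
Local Notation Cinf := (Cinf M).
Local Notation vfield := (vfield M).
Variables (Phi : {linear Tbig M -> Tbig M}) (G : gen_metric M).
Variables (gamma psi : bilin vfield).
Implicit Types (X Y Z : vfield) (s : bool).

Local Notation lift := (lift_pm gamma psi).
Local Notation F := (Fpm Phi gamma psi).

Definition clift s (x : cplx vfield) : cplx (Tbig M) :=
  (lift s x.1, lift s x.2).

Lemma clift_inj s : injective (clift s).
Proof. by move=> [x1 x2] [y1 y2] [-> _ -> _]. Qed.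

Lemma cliftD s x y : clift s (x + y) = clift s x + clift s y.
Proof. by rewrite /clift !linearD. Qed.

Hypothesis Phi_skew_g : forall x y, gpair (Phi x) y + gpair x (Phi y) = 0.
Hypothesis Phi3 : forall x, Phi (Phi (Phi x)) + Phi x = 0.
Hypothesis Phi_skew_G : forall x y, G (Phi x) y + G x (Phi y) = 0.
Hypothesis VpmE : forall s, Vpm G s = range (lift s).
Hypotheses (gammaC : symmetric_bilin gamma) (psi0 : alternating_bilin psi).

(** Paired with [y], both sides equal [- gpair (gm_sharp G x) (Phi y)]: one by [G]-skewness, the
    other by [g]-skewness. Consequently [Phi] preserves the eigenbundles [V_+-]. *)
Lemma gm_sharp_Phi x : gm_sharp G (Phi x) = Phi (gm_sharp G x).
Proof.
apply/subr0_eq/gpair_nondegenerate => y; rewrite gpairB.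
apply/eqP; rewrite subr_eq0; apply/eqP.
apply: (addIr (gpair (gm_sharp G x) (Phi y))).
have := Phi_skew_G x y; rewrite -!gm_sharpE -mulrDr Phi_skew_g.
move=> /(congr1 ( *%R (scst M 2^-1))).
by rewrite mulrA mulr_natr mulr2n scst_half mul1r mulr0.
Qed.

Lemma Phi_lift s X : Phi (lift s X) = lift s (F s X).
Proof.
have VX : Vpm G s (lift s X) by rewrite VpmE; exists X.
have : Vpm G s (Phi (lift s X)).
  by rewrite /Vpm /= gm_sharp_Phi VX linearZ.
by rewrite VpmE /Fpm => -[Y _ <-].
Qed.

Lemma Fpm_is_linear s : linear (F s).
Proof. by move=> f X Y; rewrite /Fpm !linearP. Qed.

HB.instance Definition _ s :=
  GRing.isLinear.Build Cinf vfield vfield _ (F s) (@Fpm_is_linear s).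

Lemma Fpm3 s X : F s (F s (F s X)) + F s X = 0.
Proof.
have := Phi3 (lift s X); rewrite !Phi_lift -linearD.
by move=> /(congr1 fst).
Qed.

Lemma Fpm_skew s X Y : gamma (F s X) Y + gamma X (F s Y) = 0.
Proof.
have := Phi_skew_g (lift s X) (lift s Y).
rewrite !Phi_lift !gpair_lift // -mulrDr => /(congr1 ( *%R ((-1) ^+ s))).
by rewrite mulrA -expr2 sqrr_sign mul1r mulr0.
Qed.

Lemma Vpm_cplxP s x : Vpm_cplx G s x <-> exists y, x = clift s y.
Proof.
rewrite /Vpm_cplx /= VpmE; split=> [[[X _ xX] [Y _ xY]]|[y ->]].
  by exists (X, Y); rewrite [x]surjective_pairing -xX -xY.
by split; [exists y.1 | exists y.2].
Qed.

Lemma E_clift s x : E_bundle Phi (clift s x) <-> eigen_i (F s) x.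
Proof.
rewrite /E_bundle /eigen_i /= /cmap /imul /= !Phi_lift -linearN.
split=> [|[-> ->] //]; exact: (@clift_inj s (_, _) (_, _)).
Qed.

Lemma S_clift s x : S_bundle Phi (clift s x) <-> eigen_0 (F s) x.
Proof.
rewrite /S_bundle /eigen_0 /= /cmap /= !Phi_lift.
rewrite [X in _ = X <-> _](_ : _ = clift s 0); last by rewrite /clift !linear0.
split=> [|[-> ->] //]; exact: (@clift_inj s (_, _)).
Qed.

(** * Bracket conditions on complexified lifts *)

Variable nabla : vfield -> vfield -> vfield.
Hypothesis LC : levi_civita gamma nabla.
Local Notation W := (lift_defect gamma psi nabla).

(* The real and imaginary parts of [W(x, y) = 0]. *)
Definition clift_closed s x y : Prop := forall Z,
  W s x.1 y.1 Z = W s x.2 y.2 Z /\ W s x.1 y.2 Z = - W s x.2 y.1 Z.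

(** The vector parts agree by definition, and the 1-form parts differ by the complex extension of
    [W]. *)
Lemma cbracket_clift s x y :
  cbracket (@courant _ _ M) (clift s x) (clift s y) =
    clift s (cbracket (@lie _ _ M) x y) <-> clift_closed s x y.
Proof.
set L := LHS; set K := RHS.
have re Z : L.1.2 Z = (K.1.2 Z : Cinf) + (W s x.1 y.1 Z - W s x.2 y.2 Z).
  have -> : K.1 = lift s (lie x.1 y.1) - lift s (lie x.2 y.2).
    by rewrite -linearB.
  change ((courant (lift s x.1) (lift s y.1)).2 Z -
    (courant (lift s x.2) (lift s y.2)).2 Z =
    ((lift s (lie x.1 y.1)).2 Z - (lift s (lie x.2 y.2)).2 Z) +
    (W s x.1 y.1 Z - W s x.2 y.2 Z) :> Cinf).
  by rewrite !(courant_lift gammaC psi0 LC) opprD addrACA.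
have im Z : L.2.2 Z = (K.2.2 Z : Cinf) + (W s x.1 y.2 Z + W s x.2 y.1 Z).
  have -> : K.2 = lift s (lie x.1 y.2) + lift s (lie x.2 y.1).
    by rewrite -linearD.
  change ((courant (lift s x.1) (lift s y.2)).2 Z +
    (courant (lift s x.2) (lift s y.1)).2 Z =
    ((lift s (lie x.1 y.2)).2 Z + (lift s (lie x.2 y.1)).2 Z) +
    (W s x.1 y.2 Z + W s x.2 y.1 Z) :> Cinf).
  by rewrite !(courant_lift gammaC psi0 LC) addrACA.
split=> [LK Z|W0].
  split; [apply/subr0_eq; move: (re Z) | apply/eqP; rewrite -addr_eq0;
    apply/eqP; move: (im Z)]; rewrite LK => KZ; apply/esym.
    by apply: (addrI (K.1.2 Z : Cinf)); rewrite addr0.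
  by apply: (addrI (K.2.2 Z : Cinf)); rewrite addr0.
have LK1 Z : L.1.2 Z = K.1.2 Z by rewrite re (W0 Z).1 subrr addr0.
have LK2 Z : L.2.2 Z = K.2.2 Z by rewrite im (W0 Z).2 addNr addr0.
have {}LK1 : L.1.2 = K.1.2 by exact/val_inj/funext.
have {}LK2 : L.2.2 = K.2.2 by exact/val_inj/funext.
rewrite [L]surjective_pairing [L.1]surjective_pairing [L.2]surjective_pairing.
by rewrite LK1 LK2.
Qed.

(** A section of [V_+-] is determined by its vector part, so if the bracket lies there it can only
    be the lift of the Lie bracket. *)
Lemma cbracket_clift_Vpm s x y :
  Vpm_cplx G s (cbracket (@courant _ _ M) (clift s x) (clift s y)) <->
  clift_closed s x y.
Proof.
rewrite -cbracket_clift; split=> [/Vpm_cplxP[z Lz]|->]; last first.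
  by apply/Vpm_cplxP; eexists.
rewrite Lz; congr (clift s _); rewrite [z]surjective_pairing.
have -> : z.1 = (cbracket (@lie _ _ M) x y).1.
  by rewrite -[z.1]/((clift s z).1.1) -Lz.
have -> : z.2 = (cbracket (@lie _ _ M) x y).2.
  by rewrite -[z.2]/((clift s z).2.1) -Lz.
by [].
Qed.

Lemma clift_closed_formula s :
  (forall x y, eigen_i (F s) x -> eigen_i (F s) y \/ eigen_0 (F s) y ->
     clift_closed s x y) <->
  (forall X Y Z, W s (F s (F s X)) Y Z + W s (F s X) (F s Y) Z = 0).
Proof.
have WN X Y Z : W s X (- Y) Z = - W s X Y Z by exact: lift_defectNr.
have F0 : F s 0 = 0 by exact: linear0.
have FN X : F s (- X) = - F s X by exact: linearN.
split=> [closed X Y Z|W0 [a b] [c d] [/= Fa Fb] Fcd Z] /=.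
  have FD U V : F s (U + V) = F s U + F s V by exact: linearD.
  have F3 U : F s (F s (F s U)) = - F s U.
    by apply/eqP; rewrite -addr_eq0 Fpm3.
  (* This pair is [F^2 X + i F X]; since [F^3 = - F], applying [F] multiplies it by [i]. *)
  have Hx : eigen_i (F s) (F s (F s X), F s X).
    by rewrite /eigen_i /= /cmap /imul /= F3.
  (* [Y - i F Y = (- F^2 Y - i F Y) + (Y + F^2 Y)], with summands in [H], [Q]. *)
  have Hy : eigen_i (F s) (- F s (F s Y), - F s Y).
    by rewrite /eigen_i /= /cmap /imul /= !FN F3 opprK.
  have Qy : eigen_0 (F s) (Y + F s (F s Y), 0).
    by rewrite /eigen_0 /= /cmap /= F0 FD F3 subrr.
  (* Real parts suffice: their sum is the real part of [W(F^2 X + i F X, Y - i F Y)], that is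
     [W(F^2 X, Y) + W(F X, F Y)]. *)
  have /= [h _] := closed _ _ Hx (or_introl Hy) Z.
  have /= [q _] := closed _ _ Hx (or_intror Qy) Z.
  have -> : W s (F s (F s X)) Y Z = - W s (F s X) (F s Y) Z.
    rewrite -WN -h -[Y in LHS](addrK (F s (F s Y))).
    by rewrite (lift_defectDr _ LC) q (lift_defect0r _ LC) add0r.
  by rewrite addNr.
(* From [F a = - b] and [F b = a], the element [a + i b] of [H] is [F^2 X + i F X] for [X = - a];
   this is where [W0] is instantiated. *)
have ab Y : W s a Y Z = - W s b (F s Y) Z.
  apply/eqP; rewrite -addr_eq0; apply/eqP.
  by have := W0 (- a) Y Z; rewrite !FN Fa FN !opprK Fb.
have b0 Y : F s Y = 0 -> W s b Y Z = 0.
  move=> FY; have := W0 (- b) Y Z; rewrite FY (lift_defect0r _ LC) addr0.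
  by rewrite !FN Fb Fa opprK.
(* For [c + i d] in [H], [F c = - d] and [F d = c] turn [ab] into both required equations; for
   [c + i d] in [Q] every term vanishes. *)
rewrite !ab; case: Fcd => -[/= Fc Fd].
  by rewrite Fc Fd WN opprK.
by rewrite Fc Fd !(b0 0) ?(b0 c) ?(b0 d) ?F0 ?oppr0.
Qed.

(** By [lift_defect_nabla] the left side has the form [D - 2 e g] with [e = +-1]; as [e * e = 1],
    its vanishing is solved by [g = e D / 2]. *)
Lemma lift_defect_formula s :
  (forall X Y Z, W s (F s (F s X)) Y Z + W s (F s X) (F s Y) Z = 0) <->
  (forall X Y Z, gamma (F s X) (nabla_endo nabla Z (F s) Y) =
     (-1) ^+ s * scst M 2^-1 *
       (d2form psi (F s (F s X)) Y Z + d2form psi (F s X) (F s Y) Z)).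
Proof.
have ss : (-1) ^+ s * (-1) ^+ s = 1 :> Cinf by rewrite -expr2 sqrr_sign.
have WE X Y Z := lift_defect_nabla psi gammaC LC s X Y Z (@Fpm_skew s).
have hh := scst_half M.
split=> eq0 X Y Z; move: (eq0 X Y Z) => {eq0}; rewrite WE;
  move: (gamma _ _) (_ + _) ((-1) ^+ s) (scst M _) ss hh => g D e h ee hh.
  move=> /subr0_eq ->.
  have -> : e * h * (e * (g + g)) = (e * e) * ((h + h) * g) by ring.
  by rewrite ee hh !mul1r.
move=> ->.
have -> : D - e * (e * h * D + e * h * D) = D - (e * e) * ((h + h) * D).
  by ring.
by rewrite ee hh !mul1r subrr.
Qed.

(** [Es] is the lift of [H]. Staying in [V_+-] is the vanishing of [W], and once [W] vanishes the
    bracket is the lift of the Lie bracket. *)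
Lemma cbracket_E_sub s :
  let Es := (Vpm_cplx G s `&` E_bundle Phi)%classic in
  bracket_sub (@courant _ _ M) Es Es Es <->
  bracket_sub (@lie _ _ M) (eigen_i (F s)) (eigen_i (F s)) (eigen_i (F s)) /\
  (forall x y, eigen_i (F s) x -> eigen_i (F s) y -> clift_closed s x y).
Proof.
move=> Es; have EsP x : eigen_i (F s) x -> Es (clift s x).
  by move=> Hx; split; [apply/Vpm_cplxP; exists x | apply/E_clift].
split=> [sub|[sub closed] x y].
  suff Hc x y : eigen_i (F s) x -> eigen_i (F s) y -> clift_closed s x y /\
      eigen_i (F s) (cbracket (@lie _ _ M) x y).
    by split=> x y Hx Hy; case: (Hc x y Hx Hy).
  move=> /EsP Hx /EsP Hy; have [/cbracket_clift_Vpm W0] := sub _ _ Hx Hy.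
  by rewrite (cbracket_clift _ _ _).2 // => /E_clift.
move=> [/Vpm_cplxP[{}x ->] /E_clift Hx] [/Vpm_cplxP[{}y ->] /E_clift Hy].
rewrite (cbracket_clift _ _ _).2; last exact: closed.
by apply: EsP; exact: sub.
Qed.

Lemma cbracket_ES_sub s :
  let Es := (Vpm_cplx G s `&` E_bundle Phi)%classic in
  let Ss := (Vpm_cplx G s `&` S_bundle Phi)%classic in
  bracket_sub (@courant _ _ M) Es Ss (sumset Es Ss) <->
  bracket_sub (@lie _ _ M) (eigen_i (F s)) (eigen_0 (F s))
    (sumset (eigen_i (F s)) (eigen_0 (F s))) /\
  (forall x y, eigen_i (F s) x -> eigen_0 (F s) y -> clift_closed s x y).
Proof.
move=> Es Ss; have EsP x : eigen_i (F s) x -> Es (clift s x).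
  by move=> Hx; split; [apply/Vpm_cplxP; exists x | apply/E_clift].
have SsP x : eigen_0 (F s) x -> Ss (clift s x).
  by move=> Hx; split; [apply/Vpm_cplxP; exists x | apply/S_clift].
split=> [sub|[sub closed] x y].
  suff Hc x y : eigen_i (F s) x -> eigen_0 (F s) y -> clift_closed s x y /\
      sumset (eigen_i (F s)) (eigen_0 (F s)) (cbracket (@lie _ _ M) x y).
    by split=> x y Hx Hy; case: (Hc x y Hx Hy).
  move=> /EsP Hx /SsP Hy; have [u [/Vpm_cplxP[h uE] Eu]] := sub _ _ Hx Hy.
  case=> v [/Vpm_cplxP[q vE] Sv]; move: Eu Sv; rewrite {}uE {}vE.
  move=> /E_clift Hh /S_clift Qq; rewrite -cliftD => hqE.
  (* A sum of elements of [Es] and [Ss] is again a lift, so the bracket lies in [V_+-]; injectivity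
     of the lift then carries the splitting down to [TM]. *)
  have W0 : clift_closed s x y.
    by apply/cbracket_clift_Vpm/Vpm_cplxP; exists (h + q).
  split=> //; exists h => //; exists q => //.
  by apply: (@clift_inj s); rewrite hqE; apply/cbracket_clift.
move=> [/Vpm_cplxP[{}x ->] /E_clift Hx] [/Vpm_cplxP[{}y ->] /S_clift Qy].
rewrite (cbracket_clift _ _ _).2; last exact: closed.
have [h Hh [q Qq <-]] := sub _ _ Hx Qy.
rewrite cliftD; exists (clift s h); first exact: EsP.
by exists (clift s q); first exact: SsP.
Qed.

End Associated.

(** * Assembly of the bracket conditions and the formula *)

Theorem proposition4p6 (R : realType) (n : nat) (M : manifold R n)
    (Phi : {linear Tbig M -> Tbig M}) (G : gen_metric M)
    (gamma psi : bilin (vfield M)) (nabla : vfield M -> vfield M -> vfield M) :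
  gen_metric_CRF Phi G ->
  associated_pair G gamma psi ->
  levi_civita gamma nabla ->
  gen_CRFK Phi G <->
  (forall s : bool, classical_metric_CRF (Fpm Phi gamma psi s) gamma) /\
  (forall (s : bool) (X Y Z : vfield M),
     let F := Fpm Phi gamma psi s in
     gamma (F X) (nabla_endo nabla Z F Y) =
     (-1) ^+ s * scst M 2^-1 *
       (d2form psi (F (F X)) Y Z + d2form psi (F X) (F Y) Z)).
Proof.
move=> CRF [[gammaC _] [psi0 VpmE]] LC.
have [[skew_g Phi3] skew_G _] := CRF.
have EE := cbracket_E_sub skew_g skew_G VpmE gammaC psi0 LC.
have ES := cbracket_ES_sub skew_g skew_G VpmE gammaC psi0 LC.
(* Vanishing of [W] on [H x H] and [H x Q] is linked to the stated formula through the identity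
   [W(F^2 X, Y) + W(F X, F Y) = 0]. *)
have formula s : _ <-> _ := iff_trans
  (clift_closed_formula skew_g Phi3 skew_G VpmE LC s)
  (lift_defect_formula skew_g skew_G VpmE gammaC psi0 LC s).
split=> [[_ crfk]|[classical eqF]].
  split=> s.
    have [/EE[HH _] /ES[HQ _]] := crfk s; split=> //.
    - exact: Fpm_is_linear.
    - exact: (Fpm3 skew_g Phi3 skew_G VpmE).
    - exact: (Fpm_skew skew_g skew_G VpmE gammaC psi0).
  apply/formula => x y Hx [Hy|Qy]; have [/EE[_ HH] /ES[_ HQ]] := crfk s.
    exact: HH.
  exact: HQ.
split=> // s; have [_ _ _ HH HQ] := classical s.
have closed := (formula s).2 (eqF s).
split; [apply/EE | apply/ES]; split=> // x y Hx Hy; apply: closed => //.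
  by left.
by right.
Qed.
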